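(* Consider the Q-learning algorithm (defined in the context) and an iteration index $i\ge0$. If for any $x_k\ne0$ the stopping condition $$Q_2^{(i+1)}(x_k,u_k^{(i+1)},v_k^{(i+1)})-Q_2^{(i)}(x_k,u_k^{(i)},v_k^{(i)})<r_2(x_k,u_k^{(i+1)},v_k^{(i+1)})$$ is satisfied, then the pair of solutions $(u_k^{(i+1)},v_k^{(i+1)})=(K_2^{(i+1)}x_k,K_1^{(i+1)}x_k)$ stabilizes the system asymptotically in the mean square sense; i.e., the closed-loop system $$x_{k+1}=(A_1+B_1K_2^{(i+1)}+C_1K_1^{(i+1)})x_k+(A_2+C_2K_1^{(i+1)})x_k\omega_k$$ satisfies $\lim_{k\to\infty}E(x_k^Tx_k)=0$ for every initial state $x_0\in\mathbb{R}^n$.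
   Context: System: $x_{k+1}=A_1x_k+B_1u_k+C_1v_k+(A_2x_k+C_2v_k)\omega_k$, $k\in\{0,1,2,\dots\}$, with deterministic $x_0$, $x_k\in\mathbb{R}^n$, control $u_k\in\mathbb{R}^{m_1}$, disturbance $v_k\in\mathbb{R}^{m_2}$, constant real matrices $A_1,A_2\in\mathbb{R}^{n\times n}$, $B_1\in\mathbb{R}^{n\times m_1}$, $C_1,C_2\in\mathbb{R}^{n\times m_2}$, and $(\omega_k)$ an independent scalar white noise sequence with $E\omega_k=0$, $E(\omega_s\omega_k)=\delta_{sk}$. The output is $y_k=\begin{bmatrix}Cx_k\\ Du_k\end{bmatrix}$ with $D^TD=I$, $Q=C^TC$, and $\gamma>0$ is fixed. Stage costs: $r_1(x,u,v)=E(\gamma^2v^Tv-x^TQx-u^Tu)$, $r_2(x,u,v)=E(x^TQx+u^Tu)$. Standing assumptions. A control $u_k=Kx_k$ is admissible if $x_{k+1}=(A_1+B_1K)x_k+A_2x_k\omega_k$ satisfies $\lim_{k\to\infty}E(x_k^Tx_k)=0$ for every $x_0$; at least one admissible control exists. The system is exactly observable: for $x_{k+1}=A_1x_k+A_2x_k\omega_k$, $y_k=Cx_k$, if $y_k=0$ a.s. for all $k\ge0$ then $x_0=0$. Q-learning algorithm. Put $p=n+m_1+m_2$ and $z=(x^T,u^T,v^T)^T$. For $j=1,2$, $Q_j^{(i)}(x,u,v)=E(z^TH_j^{(i)}z)$ with $H_j^{(i)}\in\mathbb{R}^{p\times p}$ symmetric, partitioned into blocks $\Gamma_j^{(i)}(a,b)$,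 $a,b\in\{1,2,3\}$, conforming to $(n,m_1,m_2)$. Start from $H_1^{(0)}=H_2^{(0)}=0$ and arbitrary initial gains $K_1^{(0)},K_2^{(0)}$. The feedbacks are $u_k^{(i)}=K_2^{(i)}x_k$, $v_k^{(i)}=K_1^{(i)}x_k$. For each $i\ge0$: (a) $P_j^{(i)}=\begin{bmatrix}I&K_2^{(i)T}&K_1^{(i)T}\end{bmatrix}H_j^{(i)}\begin{bmatrix}I&K_2^{(i)T}&K_1^{(i)T}\end{bmatrix}^T$; (b) $H_j^{(i+1)}$ is determined by $Q_j^{(i+1)}(x_k,u_k,v_k)=r_j(x_k,u_k,v_k)+E(x_{k+1}^TP_j^{(i)}x_{k+1})$, where $x_{k+1}$ is the successor of $x_k$ under $u_k,v_k$, understood as an identity of quadratic forms in $(x_k,u_k,v_k)$; (c) $\begin{bmatrix}K_1^{(i+1)}\\ K_2^{(i+1)}\end{bmatrix}=-\begin{bmatrix}\Gamma_1^{(i+1)}(3,3)&\Gamma_1^{(i+1)}(2,3)^T\\ \Gamma_2^{(i+1)}(2,3)&\Gamma_2^{(i+1)}(2,2)\end{bmatrix}^{-1}\begin{bmatrix}\Gamma_1^{(i+1)}(1,3)^T\\ \Gamma_2^{(i+1)}(1,2)^T\end{bmatrix}$ (the inverse is presupposed to exist). *)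

(* Defs.v *)
From HB Require Import structures.
From mathcomp Require Import all_boot all_order all_algebra.
From mathcomp Require Import all_classical all_reals all_analysis.

Set Implicit Arguments.
Unset Strict Implicit.
Unset Printing Implicit Defensive.

Import Order.TTheory GRing.Theory Num.Theory.
Import numFieldNormedType.Exports.

Local Open Scope classical_set_scope.
Local Open Scope ereal_scope.
Local Open Scope ring_scope.

Definition qform (R : realType) (p : nat) (M : 'M[R]_p) (z : 'cV[R]_p) : R :=
  (z^T *m M *m z) 0 0.

Definition sqnorm (R : realType) (p : nat) (z : 'cV[R]_p) : R :=
  (z^T *m z) 0 0.

(* Mutual independence: the product rule over every finite set J of times. *)
Definition independent_seq d (T : measurableType d) (R : realType)
    (P : probability T R) (w : nat -> {RV P >-> R}) : Prop :=
  forall (J : seq nat) (A : nat -> set R), uniq J ->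
    (forall k, k \in J -> measurable (A k)) ->
    P (\bigcap_(k in [set` J]) (w k @^-1` A k))
    = (\prod_(k <- J) P (w k @^-1` A k))%E.

Definition white_noise d (T : measurableType d) (R : realType)
    (P : probability T R) (w : nat -> {RV P >-> R}) : Prop :=
  [/\ independent_seq w,
      forall k, 'E_P[w k] = 0%E
    & forall s k, 'E_P[fun t => w s t * w k t] = ((s == k)%:R)%:E].

(* The random state x_k of x_{k+1} = F x_k + (G x_k) w_k with deterministic
   x_0; T is the sample space. *)
Fixpoint state (T : Type) (R : realType) (n : nat) (F G : 'M[R]_n)
    (w : nat -> T -> R) (x0 : 'cV[R]_n) (k : nat) : T -> 'cV[R]_n :=
  if k is k'.+1 then
    fun t => F *m state F G w x0 k' t + w k' t *: (G *m state F G w x0 k' t)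
  else fun=> x0.

Definition mean_square_stable d (T : measurableType d) (R : realType)
    (P : probability T R) (w : nat -> {RV P >-> R}) (n : nat)
    (F G : 'M[R]_n) : Prop :=
  forall x0 : 'cV[R]_n,
    'E_P[fun t => sqnorm (state F G w x0 k t)] @[k --> \oo] --> 0%E.

Definition admissible d (T : measurableType d) (R : realType)
    (P : probability T R) (w : nat -> {RV P >-> R}) (n m1 : nat)
    (A1 A2 : 'M[R]_n) (B1 : 'M[R]_(n, m1)) (K : 'M[R]_(m1, n)) : Prop :=
  mean_square_stable w (A1 + B1 *m K) A2.

Definition exactly_observable d (T : measurableType d) (R : realType)
    (P : probability T R) (w : nat -> {RV P >-> R}) (n q : nat)
    (A1 A2 : 'M[R]_n) (C : 'M[R]_(q, n)) : Prop :=
  forall x0 : 'cV[R]_n,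
    (forall k, {ae P, forall t, C *m state A1 A2 w x0 k t = 0}) -> x0 = 0.

(* One step of the controlled system, for a given value a of the noise. *)
Definition successor (R : realType) (n m1 m2 : nat) (A1 A2 : 'M[R]_n)
    (B1 : 'M[R]_(n, m1)) (C1 C2 : 'M[R]_(n, m2))
    (x : 'cV[R]_n) (u : 'cV[R]_m1) (v : 'cV[R]_m2) (a : R) : 'cV[R]_n :=
  A1 *m x + B1 *m u + C1 *m v + a *: (A2 *m x + C2 *m v).

(* The costs and the Q-functions are expectations, hence functions of random
   vectors X, U, V on the sample space. *)
Definition cost1 d (T : measurableType d) (R : realType) (P : probability T R)
    (n m1 m2 : nat) (gamma : R) (Q : 'M[R]_n)
    (X : T -> 'cV[R]_n) (U : T -> 'cV[R]_m1) (V : T -> 'cV[R]_m2) : \bar R :=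
  'E_P[fun t => gamma ^+ 2 * sqnorm (V t) - qform Q (X t) - sqnorm (U t)].

Definition cost2 d (T : measurableType d) (R : realType) (P : probability T R)
    (n m1 m2 : nat) (Q : 'M[R]_n)
    (X : T -> 'cV[R]_n) (U : T -> 'cV[R]_m1) (V : T -> 'cV[R]_m2) : \bar R :=
  'E_P[fun t => qform Q (X t) + sqnorm (U t)].

Definition Qfun d (T : measurableType d) (R : realType) (P : probability T R)
    (n m1 m2 : nat) (H : 'M[R]_(n + m1 + m2))
    (X : T -> 'cV[R]_n) (U : T -> 'cV[R]_m1) (V : T -> 'cV[R]_m2) : \bar R :=
  'E_P[fun t => qform H (col_mx (col_mx (X t) (U t)) (V t))].

Section Blocks.
Variables (R : realType) (n m1 m2 : nat) (H : 'M[R]_(n + m1 + m2)).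
Definition Gamma12 : 'M[R]_(n, m1) := ursubmx (ulsubmx H).
Definition Gamma22 : 'M[R]_m1 := drsubmx (ulsubmx H).
Definition Gamma13 : 'M[R]_(n, m2) := usubmx (ursubmx H).
Definition Gamma23 : 'M[R]_(m1, m2) := dsubmx (ursubmx H).
Definition Gamma33 : 'M[R]_m2 := drsubmx H.
End Blocks.

Definition Pmat (R : realType) (n m1 m2 : nat) (H : 'M[R]_(n + m1 + m2))
    (K1 : 'M[R]_(m2, n)) (K2 : 'M[R]_(m1, n)) : 'M[R]_n :=
  let L := row_mx (row_mx 1%:M K2^T) K1^T in L *m H *m L^T.

(* H' is the matrix obtained from H by the Q-function recursion with stage
   cost r and value matrix PH; x, u, v range over deterministic vectors, so
   only the noise w k is averaged out. *)
Definition Q_update d (T : measurableType d) (R : realType)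
    (P : probability T R) (w : nat -> {RV P >-> R}) (n m1 m2 : nat)
    (A1 A2 : 'M[R]_n) (B1 : 'M[R]_(n, m1)) (C1 C2 : 'M[R]_(n, m2))
    (r : (T -> 'cV[R]_n) -> (T -> 'cV[R]_m1) -> (T -> 'cV[R]_m2) -> \bar R)
    (PH : 'M[R]_n) (H' : 'M[R]_(n + m1 + m2)) : Prop :=
  H'^T = H' /\
  forall (k : nat) (x : 'cV[R]_n) (u : 'cV[R]_m1) (v : 'cV[R]_m2),
    Qfun P H' (cst x) (cst u) (cst v)
    = (r (cst x) (cst u) (cst v)
       + 'E_P[fun t => qform PH (successor A1 A2 B1 C1 C2 x u v (w k t))])%E.

Definition gain_matrix (R : realType) (n m1 m2 : nat)
    (H1 H2 : 'M[R]_(n + m1 + m2)) : 'M[R]_(m2 + m1) :=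
  block_mx (Gamma33 H1) (Gamma23 H1)^T (Gamma23 H2) (Gamma22 H2).

Definition gain_update (R : realType) (n m1 m2 : nat)
    (H1 H2 : 'M[R]_(n + m1 + m2))
    (K1 : 'M[R]_(m2, n)) (K2 : 'M[R]_(m1, n)) : Prop :=
  gain_matrix H1 H2 \in unitmx /\
  col_mx K1 K2
  = - (invmx (gain_matrix H1 H2) *m col_mx (Gamma13 H1)^T (Gamma12 H2)^T).

(* The iterations 0, ..., i of the algorithm, which produce the matrices
   and gains of index at most i.+1; nothing is required of later indices. *)
Definition Q_learning_run d (T : measurableType d) (R : realType)
    (P : probability T R) (w : nat -> {RV P >-> R}) (n m1 m2 : nat)
    (A1 A2 : 'M[R]_n) (B1 : 'M[R]_(n, m1)) (C1 C2 : 'M[R]_(n, m2))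
    (Q : 'M[R]_n) (gamma : R) (i : nat)
    (H1 H2 : nat -> 'M[R]_(n + m1 + m2))
    (K1 : nat -> 'M[R]_(m2, n)) (K2 : nat -> 'M[R]_(m1, n)) : Prop :=
  [/\ H1 0%N = 0, H2 0%N = 0 &
      forall j, (j <= i)%N ->
        [/\ Q_update w A1 A2 B1 C1 C2 (cost1 P gamma Q)
              (Pmat (H1 j) (K1 j) (K2 j)) (H1 j.+1),
            Q_update w A1 A2 B1 C1 C2 (cost2 P Q)
              (Pmat (H2 j) (K1 j) (K2 j)) (H2 j.+1)
          & gain_update (H1 j.+1) (H2 j.+1) (K1 j.+1) (K2 j.+1)]].

(* Main.v *)
Require Import Defs.
From HB Require Import structures.
From mathcomp Require Import all_boot all_order all_algebra.
From mathcomp Require Import all_classical all_reals all_analysis.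
From mathcomp Require Import measurable_realfun.
From mathcomp Require Import ring lra.

(* Let F, G be the closed-loop matrices at step i+1 and V = P_2^(i), so that
   Q_2^(i)(x, u^(i), v^(i)) = x^T V x.  The Q-function recursion turns the
   stopping condition into x^T (F^T V F + G^T V G) x < x^T V x for x <> 0, and
   V is positive semidefinite because the stage cost r_2 is nonnegative.
   Since x_k is independent of w_k, E(x_{k+1}^T V x_{k+1})
   = E(x_k^T (F^T V F + G^T V G) x_k); hence E(x_k^T V x_k) is nonincreasing,
   and its decrements dominate a multiple of E|x_k|^2. *)

Set Implicit Arguments.
Unset Strict Implicit.
Unset Printing Implicit Defensive.

Import Order.TTheory GRing.Theory Num.Theory.
Import numFieldNormedType.Exports.

Local Open Scope classical_set_scope.
Local Open Scope ring_scope.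

(** * Means of products of functions of independent variables *)

Section integral_factor.
Import HBNNSimple.

(** Linearity carries the identity from indicators to simple functions, and monotone convergence
    carries it to nonnegative [g]. In the application [Y] is the product of the remaining factors
    and [c] the product of their means. *)
Lemma ge0_integral_factor_of_indic (R : realType) (d : measure_display)
    (T : measurableType d) (P : {measure set T -> \bar R})
    (X Y : T -> R) (c : R) (g : R -> R) :
    measurable_fun setT X -> measurable_fun setT Y ->
    (forall t, 0 <= Y t) -> 0 <= c ->
    measurable_fun setT g -> (forall a, 0 <= g a) ->
    (forall A : set R, measurable A ->
       (\int[P]_t (\1_A (X t) * Y t)%:E =
        c%:E * \int[P]_t (\1_A (X t))%:E)%E) ->
  (\int[P]_t (g (X t) * Y t)%:E = c%:E * \int[P]_t (g (X t))%:E)%E.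
Proof.
move=> mX mY Y0 c0 /measurable_EFinP mg g0 indep.
pose h := nnsfun_approx measurableT mg.
have mh n : measurable_fun setT (fun t => h n (X t)).
  by apply: measurableT_comp => //; exact: measurable_funPT.
have h0 n a : 0 <= h n a by [].
have hnd a : {homo (fun n => h n a) : m n / (m <= n)%N >-> m <= n}.
  by move=> m n mn; exact/lefP/nd_nnsfun_approx.
have hcvg a : (h n a)%:E @[n --> \oo] --> (g a)%:E.
  by apply: (cvg_nnsfun_approx measurableT mg) => // b _; rewrite lee_fin.
(* [h n] is nonnegative, so negative values [r] contribute nothing. *)
have hr0 n (r : R) t : r * \1_(h n @^-1` [set r]) (X t) =
    Num.max r 0 * \1_(h n @^-1` [set r]) (X t).
  rewrite indicE; case: (boolP (_ \in _)) => [|_]; last by rewrite !mulr0.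
  by rewrite inE /= => <-; rewrite max_l.
(* The general [Z] serves both sides of the identity: [Z = Y] on the left and [Z = 1] on the right;
   likewise in [limE]. *)
have hsum n (Z : T -> R) : measurable_fun setT Z -> (forall t, 0 <= Z t) ->
    (\int[P]_t (h n (X t) * Z t)%:E = \sum_(r \in range (h n))
      (Num.max r 0)%:E * \int[P]_t (\1_(h n @^-1` [set r]) (X t) * Z t)%:E)%E.
  move=> mZ Z0.
  have mind (r : R) : measurable_fun setT
      (fun t => \1_(h n @^-1` [set r]) (X t) * Z t : R).
    apply: measurable_funM => //.
    by apply: measurableT_comp => //; exact: measurable_indic.
  have ind0 (r : R) t : 0 <= (\1_(h n @^-1` [set r]) (X t) * Z t : R).
    by rewrite mulr_ge0.
  have max0 (r : R) : 0 <= Num.max r 0 by rewrite le_max lexx orbT.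
  transitivity (\sum_(r \in range (h n)) \int[P]_t
      (Num.max r 0 * (\1_(h n @^-1` [set r]) (X t) * Z t))%:E)%E.
    rewrite -ge0_integral_fsum//.
    - apply: eq_integral => t _; rewrite fsumEFin//; congr EFin.
      rewrite fimfunE mulr_fsuml; apply: eq_fsbigr => r _.
      by rewrite hr0 mulrA.
    - by move=> r; apply/measurable_EFinP; apply: measurable_funM.
    - by move=> r t _; rewrite lee_fin mulr_ge0.
  apply: eq_fsbigr => r _; rewrite -ge0_integralZl_EFin//.
  - by move=> t _; rewrite lee_fin.
  - exact/measurable_EFinP.
have step n : (\int[P]_t (h n (X t) * Y t)%:E =
    c%:E * \int[P]_t (h n (X t))%:E)%E.
  rewrite hsum//.
  under [in RHS]eq_integral do rewrite -[X in X%:E]mulr1.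
  rewrite (hsum n (cst 1))// ge0_mule_fsumr.
    apply: eq_fsbigr => r _; under [in RHS]eq_integral do rewrite mulr1.
    by rewrite indep// muleCA.
  move=> r; rewrite mule_ge0//; first by rewrite lee_fin le_max lexx orbT.
  by apply: integral_ge0 => t _; rewrite lee_fin mulr_ge0.
have limE (Z : T -> R) : measurable_fun setT Z -> (forall t, 0 <= Z t) ->
    (\int[P]_t (h n (X t) * Z t)%:E @[n --> \oo] -->
     \int[P]_t (g (X t) * Z t)%:E)%E.
  move=> mZ Z0.
  rewrite (_ : \int[P]_t (g (X t) * Z t)%:E =
      \int[P]_t lim ((h n (X t) * Z t)%:E @[n --> \oo]))%E; last first.
    apply: eq_integral => t _; apply/esym/cvg_lim => //.
    under eq_fun do rewrite EFinM; rewrite EFinM.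
    by apply: cvgeZr => //; exact: hcvg.
  apply: cvg_monotone_convergence => //.
  - by move=> n; apply/measurable_EFinP; exact: measurable_funM.
  - by move=> n t _; rewrite lee_fin mulr_ge0.
  - by move=> t _ m n mn; rewrite lee_fin ler_wpM2r// hnd.
have := limE _ mY Y0.
under eq_fun do rewrite step.
have := limE (cst 1) (measurable_cst _) (fun=> ler01).
rewrite /=; under eq_fun do (under eq_integral do rewrite mulr1).
under eq_integral do rewrite mulr1.
move=> cvg1 cvg2; apply: (cvg_unique _ cvg2) => //.
by apply: cvgeZl cvg1.
Qed.

End integral_factor.

(** The product of the indicators is the indicator of the intersection of the preimages, so this is
    the product rule for events in integral form. *)
Lemma independent_indic (R : realType) (d : measure_display)
    (T : measurableType d) (P : probability T R) (w : nat -> {RV P >-> R})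
    (J : seq nat) (A : nat -> set R) :
    independent_seq w -> uniq J -> (forall k, k \in J -> measurable (A k)) ->
  (\int[P]_t (\prod_(k <- J) \1_(A k) (w k t))%:E
   = \prod_(k <- J) \int[P]_t (\1_(A k) (w k t))%:E)%E.
Proof.
move=> indep uJ mA.
have mwA k : k \in J -> measurable (w k @^-1` A k).
  by move=> /mA mAk; rewrite -[_ @^-1` _]setTI; exact: measurable_funPT.
have -> : (\prod_(k <- J) \int[P]_t (\1_(A k) (w k t))%:E
    = \prod_(k <- J) P (w k @^-1` A k))%E.
  rewrite big_seq [RHS]big_seq; apply: eq_bigr => k kJ.
  rewrite -[in RHS](setIT (_ @^-1` _)) -integral_indic//; last exact: mwA.
rewrite -indep//.
rewrite -[X in P X]setIT -integral_indic//; last first.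
  by apply: fin_bigcap_measurable => // k /= /mwA.
apply: eq_integral => t _; congr EFin; rewrite [RHS]indicE.
have [allA|] := pselect (forall k, k \in J -> A k (w k t)).
  rewrite mem_set//= big_seq big1// => k kJ.
  by rewrite indicE mem_set//; exact: allA.
move=> nA; rewrite memNset; last first.
  by move=> At; apply: nA.
have [k [kJ nAk]] : exists k, k \in J /\ ~ A k (w k t).
  apply: contrapT => nex; apply: nA => k kJ; apply: contrapT => nAk.
  by apply: nex; exists k.
by rewrite (bigD1_seq k kJ uJ)/= indicE (memNset nAk) mul0r.
Qed.

(** Integrability is bundled with a real value, so that means can be added and subtracted in [R]
    without finiteness side conditions. *)
Definition has_mean {R : realType} {d : measure_display} {T : measurableType d}
    (P : probability T R) (f : T -> R) (m : R) : Prop :=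
  P.-integrable setT (EFin \o f) /\ (\int[P]_t (f t)%:E = m%:E)%E.

(** Induction on a list [J1] outside which all factors are indicators: the empty list is
    [independent_indic], and [ge0_integral_factor_of_indic] passes from indicators to a general
    function at one more index. Integrability follows from nonnegativity and the finite integral. *)
Lemma ge0_has_mean_prod (R : realType) (d : measure_display)
    (T : measurableType d) (P : probability T R) (w : nat -> {RV P >-> R})
    (J : seq nat) (g : nat -> R -> R) (m : nat -> R) :
    independent_seq w -> uniq J ->
    (forall k, k \in J -> measurable_fun setT (g k)) ->
    (forall k a, k \in J -> 0 <= g k a) ->
    (forall k, k \in J -> has_mean P (g k \o w k) (m k)) ->
  has_mean P (fun t => \prod_(k <- J) g k (w k t)) (\prod_(k <- J) m k).
Proof.
move=> indep uJ mg g0 gm.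
have mw k : measurable_fun setT (w k) by exact: measurable_funPT.
have intE : (\int[P]_t (\prod_(k <- J) g k (w k t))%:E =
    (\prod_(k <- J) m k)%:E)%E.
  (* Indicators are replaced one index at a time by the functions [g k]. *)
  suff : forall J1 : seq nat, (forall k, k \in J -> k \notin J1 ->
      exists2 A, measurable A & g k = \1_A) ->
      (\int[P]_t (\prod_(k <- J) g k (w k t))%:E = (\prod_(k <- J) m k)%:E)%E.
    by move=> /(_ J); apply => k ->.
  move=> J1; elim: J1 g m mg g0 gm => [|j J1 IH] g m mg g0 gm gA.
    have /choice[A AP] : forall k, exists A,
        k \in J -> measurable A /\ g k = \1_A.
      move=> k; case: (boolP (k \in J)) => [kJ|]; last by exists setT.
      by have [A mA ->] := gA _ kJ isT; exists A.
    under eq_integral => t _.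
      rewrite big_seq; under eq_bigr => k kJ do rewrite (AP k kJ).2.
      rewrite -big_seq.
      over.
    rewrite independent_indic//; last by move=> k /AP[].
    rewrite -prodEFin big_seq [RHS]big_seq; apply: eq_bigr => k kJ.
    by rewrite -(gm k kJ).2 /= (AP k kJ).2.
  case: (boolP (j \in J)) => [jJ|jNJ]; last first.
    apply: IH => // k kJ kJ1; apply: gA => //.
    by rewrite inE negb_or kJ1 andbT; apply: contraNneq jNJ => <-.
  have splitE (X : R -> R) t :
     \prod_(k <- J) (if k == j then X else g k) (w k t) =
     X (w j t) * \prod_(k <- J | k != j) g k (w k t).
    rewrite (bigD1_seq j)//= eqxx; congr (_ * _).
    by apply: eq_bigr => k /negbTE ->.
  rewrite (bigD1_seq j)//= mulrC EFinM -(gm j jJ).2.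
  under eq_integral do rewrite (bigD1_seq j)//=.
  apply: ge0_integral_factor_of_indic => //.
  - rewrite [X in measurable_fun _ X](_ : _ = fun t =>
        \prod_(k <- [seq k <- J | k != j]) g k (w k t)); last first.
      by apply/funext => t; rewrite big_filter.
    apply: measurable_prod => k; rewrite mem_filter => /andP[_ kJ].
    by apply: measurableT_comp => //; exact: mg.
  - by move=> t; rewrite big_seq_cond prodr_ge0// => k /andP[kJ _]; exact: g0.
  - rewrite big_seq_cond prodr_ge0// => k /andP[kJ _].
    rewrite -lee_fin -(gm k kJ).2; apply: integral_ge0 => t _.
    by rewrite lee_fin; exact: g0.
  - exact: mg.
  - by move=> a; exact: g0.
  move=> A mA.
  under eq_integral do rewrite -splitE.
  pose mA' := fine (\int[P]_t (\1_A (w j t))%:E).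
  have mwA : measurable (w j @^-1` A).
    by rewrite -[_ @^-1` _]setTI; exact: measurable_funPT.
  have iA : P.-integrable setT (EFin \o (\1_A \o w j)).
    have <- : \1_(w j @^-1` A) = \1_A \o w j by [].
    exact: integrable_indic.
  (* With an indicator put at [j], every non-indicator index lies in [J1] again, so the induction
     hypothesis applies. *)
  rewrite [LHS](IH (fun k => if k == j then \1_A else g k)
                 (fun k => if k == j then mA' else m k)).
  - rewrite (bigD1_seq j)//= eqxx mulrC EFinM; congr (_ * _)%E.
      by congr EFin; apply: eq_bigr => k /negbTE ->.
    by rewrite fineK//; exact: integrable_fin_num iA.
  - move=> k kJ; case: eqP => // _; last exact: mg.
  - by move=> k a kJ; case: eqP => // _; exact: g0.
  - move=> k kJ; case: eqP => [->|_]; last exact: gm.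
    by split => //; rewrite fineK//; exact: integrable_fin_num iA.
  - move=> k kJ kJ1; case: eqP => [_|/eqP kj]; first by exists A.
    by apply: gA => //; rewrite inE negb_or kj.
split=> //.
apply/integrableP; split.
  apply/measurable_EFinP; apply: measurable_prod => k kJ.
  by apply: measurableT_comp => //; exact: mg.
under eq_integral => t _.
  rewrite gee0_abs; last first.
    by rewrite lee_fin big_seq prodr_ge0// => k kJ; exact: g0.
  over.
by rewrite intE ltry.
Qed.

(** * Arithmetic of means, and products with factors of any sign *)

Section has_mean_theory.
Context {R : realType} {d : measure_display} {T : measurableType d}.
Context {P : probability T R}.
Implicit Types (f g : T -> R) (a b : R).

Lemma has_mean_unique f a b : has_mean P f a -> has_mean P f b -> a = b.
Proof. by move=> [_ fa] [_]; rewrite fa => -[]. Qed.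

Lemma has_mean_integrable f :
  P.-integrable setT (EFin \o f) -> has_mean P f (fine (\int[P]_t (f t)%:E)).
Proof. by move=> fi; split=> //; rewrite fineK// integrable_fin_num. Qed.

Lemma has_meanD f g a b : has_mean P f a -> has_mean P g b ->
  has_mean P (fun t => f t + g t) (a + b).
Proof.
move=> [fi fa] [gi gb]; split.
  rewrite [_ \o _](_ : _ = (EFin \o f) \+ (EFin \o g))%E//.
  exact: integrableD.
by rewrite EFinD -fa -gb integralD_EFin.
Qed.

Lemma has_meanZ c f a : has_mean P f a -> has_mean P (fun t => c * f t) (c * a).
Proof.
move=> [fi fa]; split; first exact: (integrableZl measurableT c fi).
by rewrite EFinM -fa -integralZl.
Qed.

Lemma has_meanB f g a b : has_mean P f a -> has_mean P g b ->
  has_mean P (fun t => f t - g t) (a - b).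
Proof.
move=> fa /(has_meanZ (-1)); rewrite mulN1r => /(has_meanD fa).
by under eq_fun do rewrite mulN1r.
Qed.

Lemma has_mean_expectation f a : has_mean P f a -> ('E_P[f] = a%:E)%E.
Proof. by move=> [_ fa]; rewrite unlock. Qed.

Lemma has_mean_ge0 f a : (forall t, 0 <= f t) -> has_mean P f a -> 0 <= a.
Proof.
by move=> f0 [_ fa]; rewrite -lee_fin -fa integral_ge0// => t _;
  rewrite lee_fin.
Qed.

End has_mean_theory.

Lemma has_mean_prod (R : realType) (d : measure_display)
    (T : measurableType d) (P : probability T R) (w : nat -> {RV P >-> R})
    (J : seq nat) (g : nat -> R -> R) (m : nat -> R) :
    independent_seq w -> uniq J ->
    (forall k, k \in J -> measurable_fun setT (g k)) ->
    (forall k, k \in J -> has_mean P (g k \o w k) (m k)) ->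
  has_mean P (fun t => \prod_(k <- J) g k (w k t)) (\prod_(k <- J) m k).
Proof.
move=> indep uJ mg gm.
(* One index at a time, [g k] is split into its positive and negative parts. *)
suff : forall J1 : seq nat,
    (forall k a, k \in J -> k \notin J1 -> 0 <= g k a) ->
    has_mean P (fun t => \prod_(k <- J) g k (w k t)) (\prod_(k <- J) m k).
  by move=> /(_ J); apply => k a ->.
move=> J1; elim: J1 g m mg gm => [|j J1 IH] g m mg gm g0.
  by apply: ge0_has_mean_prod => // k a kJ; exact: g0.
case: (boolP (j \in J)) => [jJ|jNJ]; last first.
  apply: IH => // k a kJ kJ1; apply: g0 => //.
  by rewrite inE negb_or kJ1 andbT; apply: contraNneq jNJ => <-.
(* A nonnegative [X] in place of [g j] takes [j] off the list of indices of unknown sign, so the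
   induction hypothesis applies. This is used for both parts of [g j]. *)
have part (X : R -> R) : measurable_fun setT X -> (forall a, 0 <= X a) ->
    P.-integrable setT (EFin \o (X \o w j)) ->
    has_mean P (fun t => X (w j t) * \prod_(k <- J | k != j) g k (w k t))
      (fine (\int[P]_t (X (w j t))%:E) * \prod_(k <- J | k != j) m k).
  move=> mX X0 iX.
  set m' := fine _.
  have := IH (fun k => if k == j then X else g k)
             (fun k => if k == j then m' else m k).
  rewrite (bigD1_seq j jJ uJ)/= eqxx.
  rewrite [X in _ -> _ -> _ -> has_mean _ _ (_ * X)](_ : _ =
    \prod_(k <- J | k != j) m k); last by apply: eq_bigr => k /negbTE ->.
  under eq_fun => t.
    rewrite (bigD1_seq j jJ uJ)/= eqxx.
    under eq_bigr => k /negbTE kj do rewrite kj.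
    over.
  apply.
  - by move=> k kJ; case: eqP => // _; exact: mg.
  - move=> k kJ; case: eqP => [->|_]; last exact: gm.
    exact: has_mean_integrable.
  - move=> k a kJ kJ1; case: eqP => // /eqP kj.
    by apply: g0 => //; rewrite inE negb_or kj.
have [gji gjm] := gm j jJ.
have ip : P.-integrable setT (EFin \o ((g j)^\+ \o w j)).
  exact: integrable_funrpos.
have iN : P.-integrable setT (EFin \o ((g j)^\- \o w j)).
  exact: integrable_funrneg.
have gE a : (g j)^\+ a - (g j)^\- a = g j a.
  by rewrite -[in RHS](funrposBneg (g j)).
have mp := part _ (measurable_funrpos (mg j jJ)) (funrpos_ge0 (g j)) ip.
have mn := part _ (measurable_funrneg (mg j jJ)) (funrneg_ge0 (g j)) iN.
have mjE : m j = fine (\int[P]_t ((g j)^\+ (w j t))%:E)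
               - fine (\int[P]_t ((g j)^\- (w j t))%:E).
  apply: (has_mean_unique (gm j jJ)).
  have := has_meanB (has_mean_integrable ip) (has_mean_integrable iN).
  by under eq_fun do rewrite /= gE.
rewrite (bigD1_seq j jJ uJ)/= mjE mulrBl.
under eq_fun do rewrite (bigD1_seq j jJ uJ)/= -gE mulrBl.
exact: has_meanB.
Qed.

(** [(e != 1%N)%:R] encodes the moments 1, 0, 1 of orders 0, 1, 2 in one formula. *)
Lemma white_noise_moment (R : realType) (d : measure_display)
    (T : measurableType d) (P : probability T R) (w : nat -> {RV P >-> R})
    (k e : nat) : white_noise w -> (e <= 2)%N ->
  has_mean P (fun t => w k t ^+ e) (e != 1%N)%:R.
Proof.
move=> [_ Ew Eww].
have mw : measurable_fun setT (w k) by exact: measurable_funPT.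
have Ew2 : (\int[P]_t (w k t ^+ 2)%:E = 1)%E.
  by have := Eww k k; rewrite eqxx unlock.
have iw2 : P.-integrable setT (EFin \o (fun t => w k t ^+ 2)).
  apply/integrableP; split; first exact/measurable_EFinP/measurable_funX.
  under eq_integral do rewrite gee0_abs ?lee_fin ?sqr_ge0//.
  by rewrite Ew2 ltry.
have i1 : P.-integrable setT (EFin \o cst 1).
  exact: finite_measure_integrable_cst.
case: e => [|[|[|]]]//= _.
- under eq_fun do rewrite expr0.
  by split=> //; have := expectation_cst P 1; rewrite unlock.
- under eq_fun do rewrite expr1.
  split; last by have := Ew k; rewrite unlock.
  (* Integrability of [w k] comes from domination by [1 + w k ^+ 2], a consequence of
     [(|w k| - 1)^2 >= 0]. *)
  apply: (le_integrable measurableT _ _ (integrableD measurableT i1 iw2)).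
    exact/measurable_EFinP.
  move=> t _ /=; rewrite lee_fin [leRHS]ger0_norm ?addr_ge0 ?sqr_ge0//.
  have : 0 <= (`|w k t| - 1) ^+ 2 by exact: sqr_ge0.
  have : 0 <= `|w k t| ^+ 2 by exact: sqr_ge0.
  rewrite -[X in 1 + X]real_normK ?num_real//; nra.
Qed.

(* The consequence of the independence of [X] from [w k], [w k.+1], ... that is
   needed; it is inherited along the recursion of the state, which is quadratic
   in the noise once a quadratic form is applied. *)
Definition mean_indep_from {R : realType} {d : measure_display}
    {T : measurableType d} {P : probability T R} (w : nat -> {RV P >-> R})
    (k : nat) (X : T -> R) (m : R) : Prop :=
  forall (J : seq nat) (e : nat -> nat), uniq J ->
    (forall j, j \in J -> (k <= j)%N) -> (forall j, (e j <= 2)%N) ->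
  has_mean P (fun t => X t * \prod_(j <- J) w j t ^+ e j)
    (m * \prod_(j <- J) (e j != 1%N)%:R).

(** * Propagation of mean independence from the future noise *)

Section mean_indep_from_theory.
Context {R : realType} {d : measure_display} {T : measurableType d}.
Context {P : probability T R} (w : nat -> {RV P >-> R}).
Implicit Types (X Y : T -> R) (a b : R).

Lemma mean_indep_from_has_mean k X a :
  mean_indep_from w k X a -> has_mean P X a.
Proof.
move=> /(_ [::] (fun=> 0%N) isT); rewrite big_nil mulr1.
under eq_fun do rewrite mulr1.
by apply.
Qed.

Lemma mean_indep_from_cst k a : white_noise w -> mean_indep_from w k (cst a) a.
Proof.
move=> hw J e uJ _ e2; apply: has_meanZ.
apply: (@has_mean_prod _ _ _ _ _ _ (fun j x => x ^+ e j)
         (fun j => (e j != 1%N)%:R)) => //.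
- by case: hw.
- by move=> j _; exact: white_noise_moment.
Qed.

Lemma mean_indep_fromD k X Y a b :
  mean_indep_from w k X a -> mean_indep_from w k Y b ->
  mean_indep_from w k (fun t => X t + Y t) (a + b).
Proof.
move=> Xa Yb J e uJ kJ e2; rewrite mulrDl; under eq_fun do rewrite mulrDl.
by apply: has_meanD; [exact: Xa|exact: Yb].
Qed.

(** The hypothesis is applied to the list [k :: J] with exponent [i] at [k]: the factor [w k ^+ i]
    joins the product, and only noises after time [k] remain free. *)
Lemma mean_indep_from_noise k X a i :
  (i <= 2)%N -> mean_indep_from w k X a ->
  mean_indep_from w k.+1 (fun t => w k t ^+ i * X t) ((i != 1%N)%:R * a).
Proof.
move=> i2 Xa J e uJ kJ e2.
have kNJ : k \notin J by apply/negP => /kJ; rewrite ltnn.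
have := Xa (k :: J) (fun j => if j == k then i else e j).
have ek j : j \in J -> (if j == k then i else e j) = e j.
  by move=> jJ; case: eqP => // jk; move: kNJ; rewrite -jk jJ.
rewrite big_cons eqxx big_seq; under eq_bigr => j jJ do rewrite ek//.
rewrite -big_seq mulrA [_ * a]mulrC.
under eq_fun => t.
  rewrite big_cons eqxx big_seq; under eq_bigr => j jJ do rewrite ek//.
  rewrite -big_seq mulrA [X t * _]mulrC.
  over.
apply; first by rewrite /= kNJ.
- by move=> j; rewrite inE => /predU1P[->//|/kJ/ltnW].
- by move=> j; case: eqP.
Qed.

End mean_indep_from_theory.

(** * Quadratic forms and coercivity *)

Section quadratic_forms.
Context {R : realType} {n : nat}.
Implicit Types (M F G : 'M[R]_n) (x : 'cV[R]_n).

Lemma qformD M N x : qform (M + N) x = qform M x + qform N x.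
Proof. by rewrite /qform mulmxDr mulmxDl mxE. Qed.

Lemma qformN M x : qform (- M) x = - qform M x.
Proof. by rewrite /qform mulmxN mulNmx mxE. Qed.

Lemma qform1 x : qform 1%:M x = sqnorm x.
Proof. by rewrite /qform mulmx1. Qed.

Lemma qformZv M a x : qform M (a *: x) = a ^+ 2 * qform M x.
Proof.
rewrite /qform [(a *: x)^T]linearZ/= -!scalemxAl -scalemxAr.
by rewrite scalerA mxE -expr2.
Qed.

Lemma qformE M x : qform M x = \sum_j (\sum_i x i 0 * M i j) * x j 0.
Proof.
rewrite /qform mxE; apply: eq_bigr => j _; rewrite mxE.
by congr (_ * _); apply: eq_bigr => i _; rewrite mxE.
Qed.

Lemma sqnormE x : sqnorm x = \sum_i x i 0 ^+ 2.
Proof.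
by rewrite /sqnorm mxE; apply: eq_bigr => i _; rewrite mxE expr2.
Qed.

Lemma sqnorm_ge0 x : 0 <= sqnorm x.
Proof. by rewrite sqnormE sumr_ge0// => i _; rewrite sqr_ge0. Qed.

(* The adjoint of [S |-> F S F^T + G S G^T], which propagates the second
   moment matrix of the state. *)
Definition lyapunov_op F G M : 'M[R]_n := F^T *m M *m F + G^T *m M *m G.

Lemma qform_step M F G x a :
  qform M (F *m x + a *: (G *m x)) =
  qform (F^T *m M *m F) x
  + (a * qform (F^T *m M *m G + G^T *m M *m F) x
     + a ^+ 2 * qform (G^T *m M *m G) x).
Proof.
rewrite /qform [(_ + _)^T]linearD/= [(a *: _)^T]linearZ/= !trmx_mul.
rewrite !(mulmxDl, mulmxDr) -!(scalemxAl, scalemxAr) !mulmxA !mxE.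
ring.
Qed.

(** On the unit sphere of the sup norm, which is compact, the form attains a positive minimum.
    Homogeneity of degree 2 extends the bound to all vectors, and a comparison of norms replaces the
    sup norm by [sqnorm]. *)
Lemma qform_coercive M : (forall x, x != 0 -> 0 < qform M x) ->
  exists2 alpha : R, 0 < alpha & forall x, alpha * sqnorm x <= qform M x.
Proof.
move=> Mpos.
(* Row vectors match [EVT_min_rV]; hence the transposes below. *)
pose A := [set v : 'rV[R]_n | `|v| = 1].
have cA : compact A.
  apply: bounded_closed_compact.
    exists 1; split; first exact: num_real.
    by move=> y y1 v /= ->; exact: ltW.
  have -> : A = (fun v : 'rV[R]_n => `|v|) @^-1` [set 1] by [].
  apply: preimage_closed; last exact: closed_eq.
  by move=> v _; exact: norm_continuous.
have coordT i : continuous (fun v : 'rV[R]_n => v^T i 0).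
  rewrite (_ : (fun v => _) = (fun v : 'rV[R]_n => v 0 i)).
    exact: coord_continuous.
  by apply/funext => v; rewrite mxE.
have cq : continuous (fun v : 'rV[R]_n => qform M v^T).
  under eq_fun do rewrite qformE.
  apply: continuous_big => [|j _]; first exact: add_continuous.
  move=> v; apply: continuousM; last first.
    exact: coordT.
  apply: continuous_big => [|i _ v']; first exact: add_continuous.
  apply: continuousM; last exact: cst_continuous.
  exact: coordT.
have sphere x : x != 0 -> A (`|x^T|^-1 *: x^T).
  move=> x0; rewrite /A/= normrZ normfV normr_id mulVf// normr_eq0.
  by rewrite trmx_eq0.
have q0 a : a * sqnorm (0 : 'cV[R]_n) <= qform M 0.
  by rewrite -qform1 /qform !mulmx0 !mxE mulr0.
(* An empty sphere means that 0 is the only vector ([n = 0]), so any positive constant serves. *)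
have [A0|/set0P An0] := eqVneq A set0.
  exists 1 => // x; have [->|/sphere] := eqVneq x 0; first exact: q0.
  by rewrite A0.
have [c cinA cmin] := EVT_min_rV An0 cA (continuous_subspaceT cq).
have c0 : 0 < qform M c^T.
  apply: Mpos; rewrite trmx_eq0 -normr_eq0.
  by move: cinA; rewrite inE /A/= => ->; exact: oner_neq0.
(* The minimum is divided by a bound for the ratio of [sqnorm x] to the squared sup norm; [n.+1]
   instead of [n] is visibly positive. *)
exists (qform M c^T / n.+1%:R); first by rewrite divr_gt0// ltr0n.
move=> x; have [->|x0] := eqVneq x 0; first exact: q0.
have s0 : `|x^T| != 0 by rewrite normr_eq0 trmx_eq0.
have -> : qform M x = `|x^T| ^+ 2 * qform M (`|x^T|^-1 *: x^T)^T.
  by rewrite linearZ/= trmxK qformZv exprVn mulrA divff ?mul1r// expf_neq0.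
have xs i : x i 0 ^+ 2 <= `|x^T| ^+ 2.
  rewrite -real_normK ?num_real// lerXn2r ?nnegrE//.
  rewrite [leRHS]/Num.norm/= mx_normrE; apply/bigmax_geP; right => /=.
  by exists (0, i) => //=; rewrite mxE.
have nx : sqnorm x <= n.+1%:R * `|x^T| ^+ 2.
  rewrite sqnormE (le_trans (ler_sum _ (fun i _ => xs i)))//.
  rewrite sumr_const card_ord -[leLHS]mulr_natl ler_wpM2r ?sqr_ge0// ler_nat.
  exact: leqnSn.
rewrite -mulrA mulrC (@le_trans _ _ (`|x^T| ^+ 2 * qform M c^T))//; last first.
  by rewrite ler_wpM2l ?sqr_ge0// cmin// inE; exact: sphere.
by rewrite ler_wpM2r ?(ltW c0)// ler_pdivrMl// ltr0n.
Qed.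

End quadratic_forms.

(** * Moments of the state and the Lyapunov criterion *)

Section state_moments.
Context {R : realType} {d : measure_display} {T : measurableType d}.
Context {P : probability T R} (w : nat -> {RV P >-> R}) {n : nat}.
Context (F G : 'M[R]_n) (x0 : 'cV[R]_n) (hw : white_noise w).
Local Notation x := (state F G w x0).

(** Induction on [k] for all [M] at once, since one step of the recursion turns the form of [M] into
    three other forms with the factors 1, [w k] and [w k ^+ 2]. *)
Lemma mean_indep_from_state k M :
  exists m, mean_indep_from w k (fun t => qform M (x k t)) m.
Proof.
elim: k M => [|k IH] M.
  exists (qform M x0).
  exact: (@mean_indep_from_cst _ _ _ _ w 0 (qform M x0)).
have [m0 X0] := IH (F^T *m M *m F).
have [m1 X1] := IH (F^T *m M *m G + G^T *m M *m F).
have [m2 X2] := IH (G^T *m M *m G).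
exists ((0%N != 1%N)%:R * m0 + ((1%N != 1%N)%:R * m1 + (2%N != 1%N)%:R * m2)).
rewrite (_ : (fun t => _) = fun t =>
    w k t ^+ 0 * qform (F^T *m M *m F) (x k t) +
    (w k t ^+ 1 * qform (F^T *m M *m G + G^T *m M *m F) (x k t) +
     w k t ^+ 2 * qform (G^T *m M *m G) (x k t))); last first.
  by apply/funext => t; rewrite /= qform_step mul1r.
by do !apply: mean_indep_fromD; exact: mean_indep_from_noise.
Qed.

Lemma has_mean_state k M : exists m, has_mean P (fun t => qform M (x k t)) m.
Proof.
have [m Mm] := mean_indep_from_state k M.
by exists m; exact: mean_indep_from_has_mean Mm.
Qed.

(** The cross term has mean 0 because [E (w k) = 0], and the term in [w k ^+ 2] contributes the mean
    of its form because [E (w k ^+ 2) = 1]. *)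
Lemma has_mean_stateS k M m :
  has_mean P (fun t => qform (lyapunov_op F G M) (x k t)) m ->
  has_mean P (fun t => qform M (x k.+1 t)) m.
Proof.
have [m0 X0] := mean_indep_from_state k (F^T *m M *m F).
have [m1 X1] := mean_indep_from_state k (F^T *m M *m G + G^T *m M *m F).
have [m2 X2] := mean_indep_from_state k (G^T *m M *m G).
have Y0 := mean_indep_from_noise (isT : (0 <= 2)%N) X0.
have Y1 := mean_indep_from_noise (isT : (1 <= 2)%N) X1.
have Y2 := mean_indep_from_noise (isT : (2 <= 2)%N) X2.
have := mean_indep_from_has_mean (mean_indep_fromD Y0 (mean_indep_fromD Y1 Y2)).
have := mean_indep_from_has_mean (mean_indep_fromD X0 X2).
under eq_fun do rewrite -qformD.
(* Uniqueness of the mean identifies [m] with [m0 + m2]. *)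
move=> /has_mean_unique mE Y /mE <-.
rewrite (_ : (fun t => _) = fun t =>
    w k t ^+ 0 * qform (F^T *m M *m F) (x k t) +
    (w k t ^+ 1 * qform (F^T *m M *m G + G^T *m M *m F) (x k t) +
     w k t ^+ 2 * qform (G^T *m M *m G) (x k t))); last first.
  by apply/funext => t; rewrite /= qform_step mul1r.
by move: Y; rewrite /= mul0r add0r !mul1r.
Qed.

End state_moments.

(* [E (x_k^T V x_k)] decreases and is bounded below, so its decrements, which
   dominate a multiple of [E |x_k|^2], tend to 0. *)
Lemma mean_square_stable_of_lyapunov (R : realType) (d : measure_display)
    (T : measurableType d) (P : probability T R) (w : nat -> {RV P >-> R})
    (n : nat) (F G V : 'M[R]_n) :
    white_noise w -> (forall x, 0 <= qform V x) ->
    (forall x, x != 0 -> qform (lyapunov_op F G V) x < qform V x) ->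
  mean_square_stable w F G.
Proof.
move=> hw V0 Vdec x0.
have [|alpha alpha0 coer] := @qform_coercive _ _ (V - lyapunov_op F G V).
  by move=> x /Vdec; rewrite qformD qformN subr_gt0.
have /choice[v vP] k := has_mean_state F G x0 hw k V.
(* Writing [|x_k|^2] as the form of the identity matrix gives it a finite mean as well. *)
have /choice[s sP] k := has_mean_state F G x0 hw k 1%:M.
have s0 k : 0 <= s k.
  by apply: has_mean_ge0 (sP k) => t; rewrite qform1 sqnorm_ge0.
have v0 k : 0 <= v k by apply: has_mean_ge0 (vP k) => t.
(* The decrement is the mean of the form of [V - lyapunov_op F G V] at [x_k], which coercivity
   bounds below pointwise. *)
have svS k : alpha * s k <= v k - v k.+1.
  have [u uP] := has_mean_state F G x0 hw k (lyapunov_op F G V).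
  rewrite (has_mean_unique (vP k.+1) (has_mean_stateS hw uP)).
  rewrite -subr_ge0.
  have := has_meanB (has_meanB (vP k) uP) (has_meanZ alpha (sP k)).
  apply: has_mean_ge0 => t; rewrite subr_ge0 qform1.
  by rewrite (le_trans (coer _))// qformD qformN.
have vdec : nonincreasing_seq v.
  apply/nonincreasing_seqP => k.
  by rewrite -subr_ge0 (le_trans _ (svS k))// mulr_ge0// ltW.
have vcvg : v k @[k --> \oo] --> inf (range v).
  by apply: nonincreasing_cvgn => //; exists 0 => _ [k _ <-].
have scvg : s k @[k --> \oo] --> 0.
  apply: (@squeeze_cvgr _ _ _ _ (cst 0) (fun k => alpha^-1 * (v k - v k.+1))).
  - apply: nearW => k; rewrite /cst s0/=.
    by rewrite ler_pdivlMl.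
  - exact: cvg_cst.
  - rewrite -[X in _ --> X](mulr0 alpha^-1); apply: cvgMr.
    rewrite -[X in _ --> X](subrr (inf (range v))); apply: cvgB => //.
    by rewrite (cvg_shiftS v).
rewrite (_ : (fun k => _) = EFin \o s).
  by apply: cvg_EFin => //; exact: nearW.
apply/funext => k /=; rewrite -(has_mean_expectation (sP k)).
by under [in RHS]eq_fun do rewrite qform1.
Qed.

(** * From the Q-learning recursion to the Lyapunov inequality *)

Lemma qform_Pmat (R : realType) (n m1 m2 : nat) (H : 'M[R]_(n + m1 + m2))
    (K1 : 'M[R]_(m2, n)) (K2 : 'M[R]_(m1, n)) (x : 'cV[R]_n) :
  qform (Pmat H K1 K2) x = qform H (col_mx (col_mx x (K2 *m x)) (K1 *m x)).
Proof.
rewrite /qform /Pmat; set L := row_mx _ _.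
have -> : col_mx (col_mx x (K2 *m x)) (K1 *m x) = L^T *m x.
  by rewrite /L !tr_row_mx !trmxK trmx1 !mul_col_mx mul1mx.
by rewrite trmx_mul trmxK !mulmxA.
Qed.

Lemma qform_gram_ge0 (R : realType) (n q : nat) (C : 'M[R]_(q, n))
    (x : 'cV[R]_n) : 0 <= qform (C^T *m C) x.
Proof.
rewrite (_ : qform _ _ = sqnorm (C *m x)) ?sqnorm_ge0//.
by rewrite /qform /sqnorm trmx_mul !mulmxA.
Qed.

(** Induction along the iterations: [H2] starts at 0, and each update adds to the nonnegative cost
    the mean of a form of [Pmat], which inherits nonnegativity from the previous [H2] by
    [qform_Pmat]. *)
Lemma Q_learning_cost2_ge0 (R : realType) (d : measure_display)
    (T : measurableType d) (P : probability T R) (w : nat -> {RV P >-> R})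
    (n m1 m2 q : nat)
    (A1 A2 : 'M[R]_n) (B1 : 'M[R]_(n, m1)) (C1 C2 : 'M[R]_(n, m2))
    (C : 'M[R]_(q, n)) (gamma : R)
    (H1 H2 : nat -> 'M[R]_(n + m1 + m2))
    (K1 : nat -> 'M[R]_(m2, n)) (K2 : nat -> 'M[R]_(m1, n)) (i : nat) :
    Q_learning_run w A1 A2 B1 C1 C2 (C^T *m C) gamma i H1 H2 K1 K2 ->
  forall j, (j <= i)%N -> forall z, 0 <= qform (H2 j) z.
Proof.
move=> [_ H20 run]; elim=> [_|j IH ji] z.
  by rewrite H20 /qform mulmx0 mul0mx mxE.
have [_ [_ upd] _] := run j (ltnW ji).
rewrite -lee_fin.
(* The expectation of a constant is that constant, so the update identity applies to every [z],
   split into its blocks. *)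
have -> : ((qform (H2 j.+1) z)%:E = Qfun P (H2 j.+1) (cst (usubmx (usubmx z)))
    (cst (dsubmx (usubmx z))) (cst (dsubmx z)))%E.
  by rewrite /Qfun /= !vsubmxK expectation_cst.
rewrite (upd 0%N) adde_ge0//; apply: expectation_ge0 => t.
  by rewrite addr_ge0 ?sqnorm_ge0// qform_gram_ge0.
by rewrite qform_Pmat IH// ltnW.
Qed.

Unset Implicit Arguments.

Theorem theorem3 (R : realType) (d : measure_display) (T : measurableType d)
    (P : probability T R) (w : nat -> {RV P >-> R})
    (n m1 m2 q l : nat)
    (A1 A2 : 'M[R]_n) (B1 : 'M[R]_(n, m1)) (C1 C2 : 'M[R]_(n, m2))
    (C : 'M[R]_(q, n)) (D : 'M[R]_(l, m1)) (Q : 'M[R]_n) (gamma : R)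
    (H1 H2 : nat -> 'M[R]_(n + m1 + m2))
    (K1 : nat -> 'M[R]_(m2, n)) (K2 : nat -> 'M[R]_(m1, n)) (i : nat)
    (hw : white_noise w)
    (hD : D^T *m D = 1%:M)
    (hQ : Q = C^T *m C)
    (hgamma : 0 < gamma)
    (hadm : exists K : 'M[R]_(m1, n), admissible w A1 A2 B1 K)
    (hobs : exactly_observable w A1 A2 C)
    (hrun : Q_learning_run w A1 A2 B1 C1 C2 Q gamma i H1 H2 K1 K2)
    (hstop : forall x : 'cV[R]_n, x != 0 ->
       (Qfun P (H2 i.+1) (cst x) (cst (K2 i.+1 *m x)) (cst (K1 i.+1 *m x))
        - Qfun P (H2 i) (cst x) (cst (K2 i *m x)) (cst (K1 i *m x))
        < cost2 P Q (cst x) (cst (K2 i.+1 *m x)) (cst (K1 i.+1 *m x)))%E) :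
  mean_square_stable w
    (A1 + B1 *m K2 i.+1 + C1 *m K1 i.+1) (A2 + C2 *m K1 i.+1).
Proof.
subst Q.
have H2_ge0 := Q_learning_cost2_ge0 hrun.
set F := A1 + _ + _; set G := A2 + _.
pose V := Pmat (H2 i) (K1 i) (K2 i).
apply: (@mean_square_stable_of_lyapunov _ _ _ _ _ _ _ _ V hw) => [x|x x0].
  by rewrite qform_Pmat H2_ge0.
have [_ _ /(_ i (leqnn i))[_ [_ upd] _]] := hrun.
(* The recursion writes the first Q-value as [r_2] plus the mean of the form of [V] at the
   successor; time 0 is an arbitrary choice. *)
have := hstop x x0; rewrite (upd 0%N x) -/V.
have -> : ('E_P[fun t => qform V (successor A1 A2 B1 C1 C2 x (K2 i.+1 *m x)
    (K1 i.+1 *m x) (w 0%N t))] = (qform (lyapunov_op F G V) x)%:E)%E.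
  (* Under the new feedbacks the successor of [x] is the closed-loop state at time 1 started from
     [x], so [has_mean_stateS] applies. *)
  rewrite (_ : (fun t => _) = fun t => qform V (state F G w x 1%N t)).
    apply: has_mean_expectation; apply: has_mean_stateS => //.
    apply: mean_indep_from_has_mean.
    exact: (@mean_indep_from_cst _ _ _ _ w 0 (qform (lyapunov_op F G V) x)).
  by apply/funext => t; rewrite /= /successor /F /G !mulmxDl !mulmxA.
rewrite /cost2 /Qfun/= !expectation_cst -qform_Pmat.
(* All terms are now finite, so [r_2] cancels from both sides. *)
by rewrite lteBlDr// lteD2lE// lte_fin.
Qed.
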